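(* Let $k\ge1$, let $q$ be a prime power, and let $P=\langle\lambda,\mu\rangle$ be a plane partition of format $2\times(k+1)\times k$ with $P\subseteq\Delta$ and $\mu=\emptyset$ (i.e. $\mu_1=\dots=\mu_k=0$). The number of nondegenerate $2\times(k+1)\times k$ hypermatrices over $\mathbb F_q$ which respect $P$ is $$q^{k^2}(q-1)^{2k}\,[k+1-\lambda_1]_q[k-\lambda_2]_q\cdots[2-\lambda_k]_q\cdot[k]!_q.$$
   Context: Notation: $[n]_q=1+q+\dots+q^{n-1}$ and $[n]!_q=[n]_q[n-1]_q\cdots[1]_q$. A $2\times(k+1)\times k$ hypermatrix over a field $\mathbb{F}$ is an array $M=(M_{h,i,j})$ with entries in $\mathbb F$, $1\le h\le 2$, $1\le i\le k+1$, $1\le j\le k$; it is viewed as the pair $(M_1,M_2)$ of $(k+1)\times k$ matrices $(M_h)_{i,j}=M_{h,i,j}$. It is nondegenerate if its (Cayley / Gelfand–Kapranov–Zelevinsky) hyperdeterminant is nonzero; for this format this is known to be equivalent to the condition, which may be taken as the definition, that $c_1M_1+c_2M_2$ has full rank $k$ for all $(c_1,c_2)\neq(0,0)$ in $\overline{\mathbb F}^2$, where $\overline{\mathbb F}$ is the algebraic closure. A plane partition $P=\langle\lambda,\mu\rangle$ of format $2\times(k+1)\times k$ is a pair of weakly decreasing sequences of integers $k+1\ge\lambda_1\ge\dots\ge\lambda_k\ge0$, $k+1\ge\mu_1\ge\dots\ge\mu_k\ge0$ with $\mu_j\le\lambda_j$ for all $j$. A hypermatrix $M$ respects $P$ if $M_{1,i,j}=0$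 whenever $i>k+1-\lambda_j$ and $M_{2,i,j}=0$ whenever $i>k+1-\mu_j$. $P\subseteq\Delta$ means $\lambda_j\le k+1-j$ and $\mu_j\le k-j$ for all $1\le j\le k$. *)

(* Defs.v *)
From HB Require Import structures.
From mathcomp Require Import all_boot all_order all_algebra.
From mathcomp Require Import boolp.

Set Implicit Arguments.
Unset Strict Implicit.
Unset Printing Implicit Defensive.

Import GRing.Theory.

Definition qint (q n : nat) : nat := \sum_(i < n) q ^ i.

Definition qfact (q n : nat) : nat := \prod_(i < n) qint q i.+1.

(* Rows and columns are numbered from 0 here and from 1 in the literature:    *)
(* the ordinals i, j below stand for the row i.+1 and the column j.+1.        *)

Notation hypermatrix F k := ('M[F]_(k.+1, k) * 'M[F]_(k.+1, k))%type.

Record plane_partition (k : nat) := PlanePartition {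
  pp_lambda : 'I_k -> nat;
  pp_mu : 'I_k -> nat;
  pp_lambda_le : forall j, pp_lambda j <= k.+1;
  pp_mu_le : forall j, pp_mu j <= k.+1;
  pp_lambda_decr : forall i j : 'I_k, i <= j -> pp_lambda j <= pp_lambda i;
  pp_mu_decr : forall i j : 'I_k, i <= j -> pp_mu j <= pp_mu i;
  pp_mu_le_lambda : forall j, pp_mu j <= pp_lambda j
}.

Definition sub_Delta (k : nat) (P : plane_partition k) : Prop :=
  forall j : 'I_k,
    pp_lambda P j <= k.+1 - j.+1 /\ pp_mu P j <= k - j.+1.

Definition respects (F : fieldType) (k : nat) (M : hypermatrix F k)
    (P : plane_partition k) : Prop :=
  forall (i : 'I_k.+1) (j : 'I_k),
    (k.+1 - pp_lambda P j < i.+1 -> M.1 i j = 0%R) /\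
    (k.+1 - pp_mu P j < i.+1 -> M.2 i j = 0%R).

(* To be used with iota the embedding of F in an algebraic closure K.         *)
Definition hyper_nondegenerate (F : fieldType) (K : closedFieldType)
    (iota : {rmorphism F -> K}) (k : nat) (M : hypermatrix F k) : Prop :=
  forall c1 c2 : K, (c1, c2) <> (0%R, 0%R) ->
    \rank (c1 *: map_mx iota M.1 + c2 *: map_mx iota M.2)%R = k.

(* Main.v *)
(* Nondegeneracy of (A, B) forces A to have full rank k.  Up to the action of
   GL_(k+1) x GL_k one may take A = (0 ; I) and B = (r ; C), and then (A, B) is
   nondegenerate iff no eigenvector of C over K is killed by r, that is, iff
   the rows r, r C, ..., r C^(k-1) form a basis.  Such a pair (r, C) is
   determined by this basis and the vector r C^k, which are arbitrary, so every
   A of full rank has |GL_k(q)| q^k partners B.  The full rank A respecting the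
   shape are counted by choosing their columns one by one: column j has
   q^(d_j) - q^(j-1) possible values, where d_j = k + 1 - lambda_j. *)
Require Import Defs.
From HB Require Import structures.
From mathcomp Require Import all_boot all_order all_algebra.
From mathcomp Require Import boolp.
From mathcomp Require Import perm mxabelem zify.

Import GRing.Theory.

(** * Row-free matrices with rows in a decreasing flag *)

Lemma row_free_col_mx (F : fieldType) (m n : nat) (a : 'rV[F]_n)
    (A : 'M[F]_(m, n)) :
  row_free (col_mx a A) = row_free A && ~~ (a <= A)%MS.
Proof.
rewrite /row_free -addsmxE.
have := mxrank_leqif_sup (addsmxSr a A).
rewrite addsmx_sub submx_refl andbT => -[le_rk <-].
have := mxrank_adds_leqif a A => -[le_add _].
have := rank_leq_row A; have := rank_leq_row a.
lia.
Qed.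

(** Rows are chosen from the last to the first. The [m - i.+1] rows below row [i] are independent
    and lie in [V i], because the flag decreases, so row [i] has to avoid a subspace of [V i] of
    that dimension. *)
Lemma card_row_free_flag (F : finFieldType) (m n : nat) (V : nat -> 'M[F]_n)
    (V_decr : forall i, (V i.+1 <= V i)%MS) :
  #|[set A : 'M[F]_(m, n) | row_free A & [forall i, row i A <= V i]%MS]| =
  \prod_(i < m) (#|F| ^ \rank (V i) - #|F| ^ (m - i.+1)).
Proof.
elim: m => [|m IHm] in V V_decr *.
  rewrite big_ord0; apply/eqP/cards1P; exists 0%R.
  apply/setP=> A; rewrite !inE flatmx0 eqxx -row_leq_rank leq0n.
  by apply/forallP=> -[].
have V_le i j : i <= j -> (V j <= V i)%MS.
  move=> /subnKC <-; elim: (j - i) => [|d IHd]; rewrite ?addn0 //.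
  by rewrite addnS (submx_trans (V_decr _)).
rewrite big_ord_recl /= subSS subn0 mulnC.
under eq_bigr => i _ do rewrite /bump /= add1n subSS.
rewrite -(IHm (fun i => V i.+1)) => [|i]; last exact: V_decr.
rewrite -sum_nat_const -sum1_card.
pose g (p : 'M[F]_(m, n) * 'rV[F]_n) : 'M[F]_(m.+1, n) := col_mx p.2 p.1.
pose h (A : 'M[F]_(m.+1, n)) :=
  (dsubmx (A : 'M_(1 + m, n)), usubmx (A : 'M_(1 + m, n))).
rewrite (reindex g) /=; last first.
  exists h => [[A' a] _ | A _]; first by rewrite /h /g /= col_mxKd col_mxKu.
  by rewrite /g /h /= vsubmxK.
set S := [set A : 'M[F]_(m, n) | row_free A & [forall i, row i A <= V i.+1]%MS].
(* The new top row ranges over [V 0] minus the span of the rows below it. *)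
rewrite (eq_bigl (fun p => (p.1 \in S) && (p.2 \in rowg (V 0) :\: rowg p.1))).
  rewrite -(pair_big_dep (fun A => A \in S)
    (fun A a => a \in rowg (V 0) :\: rowg A) (fun _ _ => 1)) /=.
  apply: eq_bigr => A; rewrite inE => /andP[freeA /forallP sAV].
  have sAV0 : rowg A \subset rowg (V 0).
    rewrite rowgS; apply/row_subP => i; apply: submx_trans (sAV i) _; exact: V_le.
  by rewrite sum1_card cardsD (setIidPr sAV0) !card_rowg (eqP freeA).
move=> [A a] /=; rewrite in_setD !mem_rowg !inE.
have -> : [forall i, row i (g (A, a)) <= V i]%MS =
    (a <= V 0)%MS && [forall i : 'I_m, row i A <= V i.+1]%MS.
  have gd (i : 'I_m) : row (lift ord0 i) (g (A, a)) = row i A.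
    by rewrite -[RHS](rowKd i a A) /=; congr row; apply/val_inj.
  have gu : row ord0 (g (A, a)) = a.
    rewrite -[RHS](row_id ord0 a) -[RHS](rowKu ord0 a A) /=.
    by congr row; apply/val_inj.
  apply/forallP/andP => [sV | [sa /forallP sA] i].
    split; first by have := sV ord0; rewrite gu.
    by apply/forallP=> i; have := sV (lift ord0 i); rewrite gd.
  by case: (unliftP ord0 i) => [j|] ->; rewrite ?gd ?gu.
rewrite row_free_col_mx.
by case: (row_free A); case: (a <= A)%MS; case: (a <= _)%MS; case: [forall i, _].
Qed.

(** * Krylov matrices and nondegenerate pencils *)

Section Pencils.
Local Open Scope ring_scope.

(** This is the observability matrix of the pair ([C], [r]): its right kernel is the largest
    [C]-stable subspace killed by [r]. *)
Definition krylov_mx (F : fieldType) (n : nat) (r : 'rV[F]_n.+1)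
    (C : 'M[F]_n.+1) : 'M[F]_n.+1 :=
  \matrix_(i < n.+1) (r *m C ^+ i).

Arguments krylov_mx {F n}.

(** By Cayley-Hamilton, [C ^+ i] is a polynomial in [C] of degree at most [n], so [r *m C ^+ i] is a
    combination of the rows of the Krylov matrix. *)
Lemma krylov_mx_mul_eq0 (F : fieldType) (n : nat) (r : 'rV[F]_n.+1)
    (C : 'M[F]_n.+1) (v : 'cV[F]_n.+1) (i : nat) :
  krylov_mx r C *m v = 0 -> r *m C ^+ i *m v = 0.
Proof.
move=> Ov0.
have low (j : 'I_n.+1) : r *m C ^+ j *m v = 0.
  by have := row_mul j (krylov_mx r C) v; rewrite Ov0 row0 rowK => <-.
have -> : C ^+ i = horner_mx C (('X^i : {poly F}) %% char_poly C).
  rewrite -[in LHS](horner_mx_X C) -rmorphXn /=.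
  rewrite [in LHS](divp_eq ('X^i : {poly F}) (char_poly C)).
  by rewrite rmorphD rmorphM /= Cayley_Hamilton mulr0 add0r.
have := ltn_modp ('X^i : {poly F}) (char_poly C).
rewrite monic_neq0 ?char_poly_monic // size_char_poly.
move: ('X^i %% char_poly C) => p szp.
rewrite -[p in LHS]coefK poly_def !linear_sum /= mulmx_suml big1 // => j _.
rewrite linearZ rmorphXn /= horner_mx_X -scalemxAr -scalemxAl.
by rewrite (low (Ordinal (leq_trans (ltn_ord j) (szp : size p <= n.+1)%N))) scaler0.
Qed.

(* Factor the characteristic polynomial: the first vanishing partial product
   applied to v leaves an eigenvector, still annihilated by every r C^i. *)
Lemma unobservable_eigenvector (K : closedFieldType) (n : nat)
    (r : 'rV[K]_n.+1) (C : 'M[K]_n.+1) (v : 'cV[K]_n.+1) (v_neq0 : v != 0)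
    (rCv0 : forall i, r *m C ^+ i *m v = 0) :
  exists a : K, exists2 w : 'cV[K]_n.+1, w != 0 & C *m w = a *: w /\ r *m w = 0.
Proof.
have [s def_s] := closed_field_poly_normal (char_poly C).
have := Cayley_Hamilton C.
rewrite def_s (monicP (char_poly_monic C)) scale1r => s0.
have {s0 def_s}: horner_mx C (\prod_(z <- s) ('X - z%:P)) *m v = 0.
  by rewrite s0 mul0mx.
elim: s v v_neq0 rCv0 => [|a s IHs] v v_neq0 rCv0.
  by rewrite big_nil rmorph1 mul1mx => /eqP; rewrite (negPf v_neq0).
rewrite big_cons mulrC rmorphM /= -mulmxA rmorphB /= horner_mx_X horner_mx_C.
rewrite mulmxBl mul_scalar_mx.
have [/eqP|w_neq0 /IHs] := eqVneq (C *m v - a *: v) 0.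
  rewrite subr_eq0 => /eqP Cv _; exists a, v => //; split=> //.
  by have := rCv0 0; rewrite expr0 mulmx1.
apply=> // i; rewrite mulmxBr -scalemxAr rCv0 scaler0 subr0.
by rewrite mulmxA -(mulmxA r) -[C ^+ i *m C]exprSr rCv0.
Qed.

Lemma mxrank_full_colP (F : fieldType) (m n : nat) (M : 'M[F]_(m, n)) :
  \rank M = n <-> forall v : 'cV[F]_n, M *m v = 0 -> v = 0.
Proof.
split=> [rkM v Mv0 | M_inj].
  have /row_fullP[B BM] : row_full M by rewrite /row_full rkM.
  by rewrite -[v]mul1mx -BM -mulmxA Mv0 mulmx0.
(* The columns of [cokermx M] are killed by [M], so they vanish; the rank of this matrix is
   [n - \rank M]. *)
have coker0 : cokermx M = 0.
  apply/matrixP=> i j.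
  have /colP/(_ i) : col j (cokermx M) = 0.
    by apply: M_inj; rewrite colE mulmxA mulmx_coker mul0mx.
  by rewrite !mxE.
have := mxrank_coker M; rewrite coker0 mxrank0; have := rank_leq_col M.
lia.
Qed.

Lemma hyper_nondegenerate_mul (F : fieldType) (K : closedFieldType)
    (iota : {rmorphism F -> K}) (k : nat) (L : 'M[F]_k.+1) (R : 'M[F]_k)
    (L_unit : L \in unitmx) (R_unit : R \in unitmx) (A B : 'M[F]_(k.+1, k)) :
  hyper_nondegenerate iota (L *m A *m R, L *m B *m R) <->
  hyper_nondegenerate iota (A, B).
Proof.
suff rkE c1 c2 :
    \rank (c1 *: map_mx iota (L *m A *m R) + c2 *: map_mx iota (L *m B *m R))%R =
    \rank (c1 *: map_mx iota A + c2 *: map_mx iota B)%R.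
  split=> ndg c1 c2 c_neq0; first exact: etrans (esym (rkE c1 c2)) (ndg _ _ c_neq0).
  exact: etrans (rkE c1 c2) (ndg _ _ c_neq0).
have -> : c1 *: map_mx iota (L *m A *m R) + c2 *: map_mx iota (L *m B *m R) =
    map_mx iota L *m (c1 *: map_mx iota A + c2 *: map_mx iota B) *m map_mx iota R.
  by rewrite !map_mxM mulmxDr mulmxDl -!scalemxAr -!scalemxAl.
rewrite mxrankMfree ?row_free_unit ?map_unitmx //.
by rewrite eqmxMfull ?row_full_unit ?map_unitmx.
Qed.

(** A pair ([r], [C]) corresponds to its Krylov matrix [O] and the vector [w = r *m C ^+ n.+1].
    Conversely [r] is the first row of [O], and [O *m C] is [O] moved up by one row with [w] placed
    last, which determines [C] as [O] is invertible. *)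
Lemma card_krylov_unit (F : finFieldType) (n : nat) :
  #|[set p : 'rV[F]_n.+1 * 'M[F]_n.+1 | krylov_mx p.1 p.2 \in unitmx]| =
  (#|[set O : 'M[F]_n.+1 | O \in unitmx]| * #|F| ^ n.+1)%N.
Proof.
pose shift (O : 'M[F]_n.+1) (w : 'rV[F]_n.+1) : 'M[F]_n.+1 :=
  \matrix_i (if (i.+1 < n.+1)%N then row (inord i.+1) O else w).
pose g (p : 'M[F]_n.+1 * 'rV[F]_n.+1) := (row ord0 p.1, invmx p.1 *m shift p.1 p.2).
have shift_last O w : row ord_max (shift O w) = w by rewrite rowK ltnn.
have gK O w : O \in unitmx -> krylov_mx (g (O, w)).1 (g (O, w)).2 = O.
  move=> O_unit; rewrite /g /=; apply/row_matrixP=> -[i lt_i]; rewrite rowK /=.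
  elim: i lt_i => [|i IHi] lt_i.
    by rewrite expr0 mulmx1; congr row; apply/val_inj.
  rewrite exprSr mulmxA (IHi (ltnW lt_i)) -row_mul mulKVmx // rowK /= lt_i.
  by congr row; apply/val_inj; rewrite /= inordK.
have <- : #|setX [set O : 'M[F]_n.+1 | O \in unitmx] [set: 'rV[F]_n.+1]| =
   (#|[set O : 'M[F]_n.+1 | O \in unitmx]| * #|F| ^ n.+1)%N.
  by rewrite cardsX cardsT card_mx mul1n.
rewrite -(card_in_imset (f := g)) => [|[O w] [O' w']]; last first.
  rewrite !inE !andbT /= => uO uO' eq_g.
  have eqO : O = O' by rewrite -(gK _ w uO) eq_g gK.
  move: eq_g; rewrite -{}eqO => -[/(congr1 (mulmx O))]; rewrite !mulKVmx // => eq_sh.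
  by rewrite -(shift_last O w) eq_sh shift_last.
congr #|pred_of_set _|; apply/setP=> -[r C]; rewrite inE /=.
apply/idP/imsetP => [uO | [[O w]]]; last first.
  by rewrite !inE andbT /= => uO [-> ->]; rewrite (gK O w).
exists (krylov_mx r C, r *m C ^+ n.+1); first by rewrite !inE uO.
rewrite /g /= rowK expr0 mulmx1; congr (_, _).
rewrite -[C in LHS](mulKmx uO); congr mulmx; apply/row_matrixP=> i.
rewrite row_mul !rowK -mulmxA -[C ^+ i *m C]exprSr.
(* A row before the last comes from the next Krylov row; the last one has [i = n] and is [w]. *)
case: ltnP => [lt_i | ge_i]; first by rewrite inordK.
by congr (_ *m _ ^+ _); apply/eqP; rewrite eqn_leq ge_i ltn_ord.
Qed.

Lemma map_krylov_mx (F K : fieldType) (f : {rmorphism F -> K}) (n : nat)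
    (r : 'rV[F]_n.+1) (C : 'M[F]_n.+1) :
  map_mx f (krylov_mx r C) = krylov_mx (map_mx f r) (map_mx f C).
Proof.
by apply/row_matrixP=> i; rewrite -map_row !rowK map_mxM rmorphXn.
Qed.

(** A nonzero kernel vector of a member of this pencil is exactly an eigenvector of [C] over [K]
    killed by [r], and such a vector exists iff the Krylov matrix is singular. *)
Lemma hyper_nondegenerate_krylov (F : fieldType) (K : closedFieldType)
    (iota : {rmorphism F -> K}) (n : nat) (r : 'rV[F]_n.+1) (C : 'M[F]_n.+1) :
  @hyper_nondegenerate F K iota n.+1
     ((col_mx 0 1%:M : 'M_(1 + n.+1, n.+1)), (col_mx r C : 'M_(1 + n.+1, n.+1))) <->
  krylov_mx r C \in unitmx.
Proof.
pose r' := map_mx iota r; pose C' := map_mx iota C.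
have pencilE c1 c2 (v : 'cV[K]_n.+1) :
    (c1 *: map_mx iota (col_mx 0 1%:M : 'M_(1 + n.+1, n.+1)) +
     c2 *: map_mx iota (col_mx r C : 'M_(1 + n.+1, n.+1))) *m v =
    col_mx (c2 *: (r' *m v)) (c1 *: v + c2 *: (C' *m v)).
  rewrite !map_col_mx map_mx0 map_mx1 mulmxDl -!scalemxAl !mul_col_mx mul0mx mul1mx.
  by rewrite !scale_col_mx add_col_mx scaler0 add0r.
split=> [ndg | uO c1 c2 c_neq0].
  rewrite -row_full_unit /row_full; apply/eqP/mxrank_full_colP => v Ov0.
  apply/eqP/contraT=> v_neq0.
  have v'_neq0 : map_mx iota v != 0 by rewrite map_mx_eq0.
  have [i|a [w w_neq0 [Cw rw]]] := unobservable_eigenvector _ _ r' C' _ v'_neq0.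
    apply: krylov_mx_mul_eq0.
    by rewrite -map_krylov_mx -map_mxM Ov0 map_mx0.
  (* With these coefficients the lower block sends [w] to [C' *m w - a *: w], which is zero. *)
  have neq0 : (- a, 1) <> (0, 0) :> K * K by case=> _ /eqP; rewrite oner_eq0.
  have /mxrank_full_colP/(_ w) := ndg _ _ neq0.
  rewrite pencilE rw Cw scaler0 scale1r scaleNr addNr col_mx0 => /(_ erefl) w0.
  by rewrite w0 eqxx in w_neq0.
apply/mxrank_full_colP => v; rewrite pencilE -(col_mx0 _ 1 n.+1 1) => Mv0.
have [rv Cv] := @eq_col_mx _ 1 n.+1 1 _ _ _ _ Mv0.
have uO' : krylov_mx r' C' \in unitmx by rewrite -map_krylov_mx map_unitmx.
(* If [c2] is zero, the identity block alone kills [v]. Otherwise [v] satisfies the eigenvector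
   equation for [- (c1 / c2)], and every row of the Krylov matrix annihilates it. *)
have [c2_0|c2_neq0] := eqVneq c2 0.
  move: Cv; rewrite c2_0 scale0r addr0 => /eqP; rewrite scaler_eq0.
  by case/orP=> /eqP // c1_0; case: c_neq0; rewrite c1_0 c2_0.
have rv0 : r' *m v = 0 by apply/eqP; move/eqP: rv; rewrite scaler_eq0 (negPf c2_neq0).
have Cv' : C' *m v = (- (c1 / c2)) *: v.
  apply: (scalerI c2_neq0); rewrite scalerA mulrN mulrCA divff // mulr1 scaleNr.
  by apply/eqP; rewrite -addr_eq0 addrC Cv.
rewrite -(mulKmx uO' v); suff -> : krylov_mx r' C' *m v = 0 by rewrite mulmx0.
apply/row_matrixP=> i; rewrite row_mul rowK row0 -mulmxA.
suff -> : C' ^+ i *m v = (- (c1 / c2)) ^+ i *: v by rewrite -scalemxAr rv0 scaler0.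
elim: (nat_of_ord i) => [|j IHj]; first by rewrite !expr0 mul1mx scale1r.
by rewrite exprSr -mulmxA Cv' -scalemxAr IHj scalerA -exprS.
Qed.

Lemma card_hyper_nondegenerate_fst (F : finFieldType) (K : closedFieldType)
    (iota : {rmorphism F -> K}) (n : nat) (A : 'M[F]_(n.+2, n.+1))
    (rkA : \rank A = n.+1) :
  #|[set B : 'M[F]_(n.+2, n.+1) | `[< hyper_nondegenerate iota (A, B) >]]| =
  (#|[set O : 'M[F]_n.+1 | O \in unitmx]| * #|F| ^ n.+1)%N.
Proof.
pose A0 : 'M[F]_(n.+2, n.+1) := col_mx (0 : 'rV_n.+1) 1%:M.
have rkA0 : \rank A0 = n.+1.
  exact: etrans (rank_col_0mx 1 (1%:M : 'M[F]_n.+1)) (mxrank1 _ _).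
have [L [R [L_unit R_unit defA]]] : exists L, exists R,
    [/\ L \in unitmx, R \in unitmx & L *m A0 *m R = A].
  (* Gaussian elimination brings [A] and [A0] to the same [pid_mx], as their ranks agree; the two
     factorizations are then composed. *)
  exists (col_ebase A *m invmx (col_ebase A0)), (invmx (row_ebase A0) *m row_ebase A).
  split; rewrite ?unitmx_mul ?unitmx_inv ?col_ebase_unit ?row_ebase_unit //.
  rewrite -[X in _ *m X *m (_ *m _) = _]mulmx_ebase -[RHS]mulmx_ebase rkA rkA0.
  by rewrite !mulmxA !(mulmxKV, mulmxK) ?col_ebase_unit ?row_ebase_unit.
pose g (p : 'rV[F]_n.+1 * 'M[F]_n.+1) : 'M[F]_(n.+2, n.+1) :=
  L *m (col_mx p.1 p.2 : 'M_(1 + n.+1, n.+1)) *m R.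
rewrite -card_krylov_unit -(card_imset (f := g)) => [|[r C] [r' C']]; last first.
  move/(can_inj (mulmxK R_unit))/(can_inj (mulKmx L_unit)) => eq_rC.
  by have [/= -> ->] := @eq_col_mx _ 1 n.+1 n.+1 _ _ _ _ eq_rC.
congr #|pred_of_set _|; apply/setP=> B; rewrite inE.
apply/asboolP/imsetP => [|[[r C]]].
  pose B' : 'M_(1 + n.+1, n.+1) := invmx L *m B *m invmx R.
  have -> : B = g (usubmx B', dsubmx B').
    by rewrite /g /= vsubmxK /B' mulmxA mulmxKV // mulKVmx.
  rewrite -defA => /(hyper_nondegenerate_mul _ _ _ _ _ _ L_unit R_unit).
  move=> /hyper_nondegenerate_krylov uO.
  by exists (usubmx B', dsubmx B'); rewrite ?inE.
rewrite inE /= => uO ->; rewrite -defA.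
apply/hyper_nondegenerate_mul => //; exact/hyper_nondegenerate_krylov.
Qed.

(** Right multiplication by [pid_mx r] truncates a row to its first [r] entries, so its row space
    consists of the rows supported there. *)
Lemma sub_pid_mxE (F : fieldType) (m r : nat) (v : 'rV[F]_m) :
  (v <= (pid_mx r : 'M_m))%MS = [forall j : 'I_m, (r <= j)%N ==> (v 0 j == 0)].
Proof.
have mul_pidE (w : 'rV[F]_m) j :
    (w *m (pid_mx r : 'M_m)) 0 j = if (j < r)%N then w 0 j else 0.
  rewrite mxE (bigD1 j) //= big1 ?addr0 => [|i neq_ij]; rewrite mxE.
    by rewrite eqxx; case: (j < r)%N; rewrite ?mulr1 ?mulr0.
  by rewrite (negPf (neq_ij : val i != val j)) mulr0.
apply/submxP/forallP => [[D ->] j | v0].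
  by rewrite mul_pidE ltnNge; case: (r <= j)%N => /=.
exists v; apply/rowP=> j; rewrite mul_pidE ltnNge; have := v0 j.
by case: (r <= j)%N => //= /eqP.
Qed.

End Pencils.

(** * Full rank matrices with columns of prescribed height *)

Lemma card_full_rank_profile (F : finFieldType) (m k : nat) (d : nat -> nat)
    (d_incr : {homo d : i j / i <= j}) (d_le : forall j, j < k -> d j <= m) :
  #|[set A : 'M[F]_(m, k) | (\rank A == k) &
      [forall j : 'I_k, forall i : 'I_m, (d j <= i) ==> (A i j == 0%R)]]| =
  \prod_(j < k) (#|F| ^ d j - #|F| ^ j).
Proof.
(* card_row_free_flag wants the largest space first, whence the reversal. *)
pose V i : 'M[F]_m := pid_mx (d (k - i.+1)).
(* Past [k], truncated subtraction keeps [V] constant at [pid_mx (d 0)], so the inclusion holds for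
   every [i]. *)
have V_decr i : (V i.+1 <= V i)%MS.
  apply/row_subP=> l; have := row_sub l (V i.+1); rewrite !sub_pid_mxE.
  move=> /forallP v0; apply/forallP=> j; apply/implyP=> le_dj.
  apply: (implyP (v0 j)); apply: leq_trans le_dj; apply: d_incr; lia.
pose s := perm (@rev_ord_inj k).
have sK : involutive s by move=> i; rewrite !permE rev_ordK.
pose g (A : 'M[F]_(m, k)) := row_perm s A^T%R.
have row_permK : involutive (row_perm s : 'M[F]_(k, m) -> 'M_(k, m)).
  by move=> A; apply/matrixP=> i j; rewrite !mxE sK.
have g_bij : bijective g.
  exists (fun B => (row_perm s B)^T%R) => [A|B]; first by rewrite /g row_permK trmxK.
  by rewrite /g trmxK row_permK.
rewrite (reindex_inj rev_ord_inj) /=.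
have -> : \prod_(j < k) (#|F| ^ d (k - j.+1) - #|F| ^ (k - j.+1)) =
    \prod_(j < k) (#|F| ^ \rank (V j) - #|F| ^ (k - j.+1)).
  apply: eq_bigr => j _; rewrite rank_pid_mx //; apply: d_le; have := ltn_ord j; lia.
rewrite -(card_row_free_flag F k m V V_decr) -(on_card_preimset (f := g)); last first.
  by case: g_bij => g' gK g'K; exists g' => ? _.
congr #|pred_of_set _|; apply/setP=> A; rewrite !inE; congr andb.
  rewrite /row_free /g row_permE eqmxMfull ?row_full_unit ?unitmx_perm //.
  by rewrite mxrank_tr.
apply/forallP/forallP => A0 i.
  rewrite sub_pid_mxE; apply/forallP=> j; rewrite !mxE permE.
  exact: (forallP (A0 (rev_ord i))).
have := A0 (rev_ord i); rewrite sub_pid_mxE => /forallP A0i.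
apply/forallP=> j; have := A0i j; rewrite !mxE permE rev_ordK.
(* The index [k - (rev_ord i).+1] is by conversion the value of the double reversal of [i]. *)
by rewrite -[X in d X]/(nat_of_ord (rev_ord (rev_ord i))) rev_ordK.
Qed.

Lemma card_unitmx (F : finFieldType) (k : nat) :
  #|[set O : 'M[F]_k | O \in unitmx]| = \prod_(j < k) (#|F| ^ k - #|F| ^ j).
Proof.
rewrite -(card_full_rank_profile F k k (fun=> k)) //.
apply: eq_card => O; rewrite !inE -row_free_unit /row_free.
case: eqP => //= _; apply/esym/forallP=> j; apply/forallP=> i.
by rewrite leqNgt ltn_ord.
Qed.

(** * From differences of powers to q-integers *)

Lemma subn_expn_qint (q j n : nat) (le_jn : j <= n) :
  q ^ n - q ^ j = q ^ j * ((q - 1) * qint q (n - j)).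
Proof.
by rewrite subn1 -predn_exp -subn1 mulnBr muln1 -expnD subnKC.
Qed.

Lemma prod_subn_expn_qint (q k : nat) (d : nat -> nat)
    (d_ge : forall j, j < k -> j <= d j) :
  \prod_(j < k) (q ^ d j - q ^ j) =
  q ^ (\sum_(j < k) j) * ((q - 1) ^ k * \prod_(j < k) qint q (d j - j)).
Proof.
under eq_bigr => j _ do rewrite subn_expn_qint ?d_ge //.
by rewrite !big_split /= expn_sum prod_nat_const card_ord.
Qed.

(** This accounts for the exponent of [q]: the columns of the first layer and the Krylov basis each
    contribute the sum of the [j], and the free vector [r C^k] contributes [k]. *)
Lemma sum_ord_sqr (k : nat) : 2 * \sum_(j < k) j + k = k ^ 2.
Proof.
elim: k => [|k]; first by rewrite big_ord0.
by rewrite big_ord_recr /= -!mulnn; move: (\sum_(j < k) j) => s; lia.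
Qed.

Lemma qfact_rev (q k : nat) : \prod_(j < k) qint q (k - j) = qfact q k.
Proof.
rewrite (reindex_inj rev_ord_inj); apply: eq_bigr => j _ /=.
by rewrite subKn.
Qed.

Theorem theorem3p7 (k : nat) (k_gt0 : 0 < k)
    (q : nat) (F : finFieldType) (card_F : #|F| = q)
    (K : closedFieldType) (iota : {rmorphism F -> K})
    (K_alg : integralRange iota)
    (P : plane_partition k) (P_Delta : sub_Delta P)
    (P_mu : forall j : 'I_k, pp_mu P j = 0) :
  #|[set M : hypermatrix F k | `[< hyper_nondegenerate iota M /\ respects M P >]]| =
  q ^ (k ^ 2) * (q - 1) ^ (2 * k)
    * (\prod_(j < k) qint q (k.+2 - j.+1 - pp_lambda P j)) * qfact q k.
Proof.
case: k k_gt0 P P_Delta P_mu => // n _ P P_Delta P_mu {K_alg}.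
(* Clamping by [minn] keeps [d] monotone on all naturals; an index out of range would otherwise fall
   back to column 0 through [inord]. *)
pose d j := n.+2 - pp_lambda P (inord (minn j n)).
have dE (j : 'I_n.+1) : d j = n.+2 - pp_lambda P j.
  by rewrite /d (minn_idPl _) ?inord_val // -ltnS.
have d_incr : {homo d : i j / i <= j}.
  move=> i j le_ij; apply: leq_sub2l; apply: pp_lambda_decr.
  by rewrite !inordK; lia.
(* Containment in [Delta] bounds the part by [n.+1 - j], so even [j < d j] and no difference of
   powers is truncated. *)
have d_ge j : j < n.+1 -> j <= d j.
  move=> lt_j; have [+ _] := P_Delta (Ordinal lt_j).
  by have := dE (Ordinal lt_j) => /= ->; lia.
pose shaped (A : 'M[F]_(n.+2, n.+1)) :=
  [forall j : 'I_n.+1, forall i : 'I_n.+2, (d j <= i) ==> (A i j == 0%R)].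
pose SA := [set A : 'M[F]_(n.+2, n.+1) | (\rank A == n.+1) & shaped A].
pose SB A := [set B : 'M[F]_(n.+2, n.+1) | `[< hyper_nondegenerate iota (A, B) >]].
have respectsE (M : hypermatrix F n.+1) : respects M P <-> shaped M.1.
  split=> [resp | shM i j].
    apply/forallP=> j; apply/forallP=> i; apply/implyP; rewrite dE => le_di.
    by apply/eqP; apply: (resp i j).1.
  (* As [mu] is zero, the second layer would be constrained only below its last row. *)
  split=> [lt_i|]; last by rewrite P_mu subn0 ltnNge ltn_ord.
  by apply/eqP; apply: (implyP (forallP (forallP shM j) i)); rewrite dE.
have rk_fst (A B : 'M[F]_(n.+2, n.+1)) :
    hyper_nondegenerate iota (A, B) -> \rank A = n.+1.
  have neq0 : (1%R, 0%R) <> (0%R, 0%R) :> K * K by case=> /eqP; rewrite oner_eq0.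
  by move=> nd; have := nd _ _ neq0; rewrite scale0r addr0 scale1r mxrank_map.
rewrite -sum1dep_card (eq_bigl (fun M => (M.1 \in SA) && (M.2 \in SB M.1))); last first.
  move=> [A B]; rewrite !inE /=; apply/asboolP/andP => [[nd /respectsE sh] | ].
    by split; [rewrite (rk_fst A B) ?eqxx | apply/asboolP].
  by move=> [/andP[_ sh] /asboolP nd]; split=> //; apply/respectsE.
rewrite -(pair_big_dep (fun A => A \in SA) (fun A B => B \in SB A) (fun _ _ => 1)) /=.
have -> : \sum_(A in SA) \sum_(B in SB A) 1 =
    \sum_(A in SA) \prod_(j < n.+1) (q ^ n.+1 - q ^ j) * q ^ n.+1.
  apply: eq_bigr => A; rewrite inE => /andP[/eqP rkA _].
  by rewrite sum1_card card_hyper_nondegenerate_fst // card_unitmx card_F.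
rewrite sum_nat_const card_full_rank_profile // => [|j _]; last exact: leq_subr.
rewrite card_F (prod_subn_expn_qint _ _ d) //.
rewrite (prod_subn_expn_qint _ _ (fun=> n.+1)) => [|j]; last exact: ltnW.
rewrite qfact_rev -sum_ord_sqr.
have -> : \prod_(j < n.+1) qint q (d j - j) =
    \prod_(j < n.+1) qint q (n.+3 - j.+1 - pp_lambda P j).
  by apply: eq_bigr => j _; rewrite dE subSS subnAC.
rewrite mul2n -addnn !expnD mul2n -addnn expnD.
(* Once the powers are abstracted, both sides are the same monomial up to reordering. *)
move: (q ^ \sum_(j < n.+1) j) ((q - 1) ^ n.+1) (q ^ n.+1) (qfact q n.+1) => a b c e.
move: (\prod_(j < n.+1) _) => p.
lia.
Qed.
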